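(* Let $S$ be a numerical semigroup with genus $g$ and type $t$, $S\neq\mathbb{N}$. Then $$2^t\le |\mathcal{C}\ell(S)|\le 2^g-2^{g-t}+1.$$
   Context: $\mathbb{N}$ denotes the non-negative integers. A numerical semigroup $S$ is a submonoid of $(\mathbb{N},+)$ with finite complement in $\mathbb{N}$. Its set of gaps is $\mathrm{G}(S)=\mathbb{N}\setminus S$ and its genus is $|\mathrm{G}(S)|$. The order $\le_S$ on $\mathbb{Z}$ is defined by $a\le_S b$ if and only if $b-a\in S$. The pseudo-Frobenius numbers of $S$ are the maximal elements of $\mathrm{G}(S)$ with respect to $\le_S$; their set is $\mathrm{PF}(S)$, and the type of $S$ is $|\mathrm{PF}(S)|$. An ideal of $S$ is a non-empty set $E\subseteq\mathbb{Z}$ with $S+E\subseteq E$ and such that $s+E\subseteq S$ for some $s\in S$. The set $\mathcal{I}(S)$ of ideals of $S$ is a commutative monoid under $I+J=\{i+j: i\in I, j\in J\}$, with identity $S$. Define the congruence $I\sim J$ if $I=z+J$ for some $z\in\mathbb{Z}$. The ideal class monoid is $\mathcal{C}\ell(S)=\mathcal{I}(S)/\sim$. *)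

(* Defs.v *)
From mathcomp Require Import all_boot all_order all_algebra.
From mathcomp Require Import all_classical.

Set Implicit Arguments.
Unset Strict Implicit.
Unset Printing Implicit Defensive.

Import Order.TTheory GRing.Theory Num.Theory.

Local Open Scope ring_scope.
Local Open Scope classical_set_scope.

Definition numerical_semigroup (S : set nat) : Prop :=
  [/\ S 0%N,
      (forall a b : nat, S a -> S b -> S (a + b)%N)
    & finite_set (~` S)].

Definition gaps (S : set nat) : set nat := ~` S.

Definition intset (S : set nat) : set int := [set s%:Z | s in S].

Definition le_sg (S : set nat) (a b : int) : Prop := intset S (b - a).

Definition pseudo_frobenius (S : set nat) : set nat :=
  [set x | gaps S x /\ forall y : nat, gaps S y -> le_sg S x y -> y = x].

Definition setsum (I J : set int) : set int := [set i + j | i in I & j in J].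

Definition translate (z : int) (J : set int) : set int := [set z + j | j in J].

Definition sg_ideal (S : set nat) (E : set int) : Prop :=
  [/\ E !=set0,
      setsum (intset S) E `<=` E
    & exists2 s : nat, S s & translate s E `<=` intset S].

Definition ideal_equiv (I J : set int) : Prop :=
  exists z : int, I = translate z J.

(* The underlying set of the ideal class monoid: a class is represented as the
   set of all ideals equivalent to a given one. *)
Definition ideal_class (S : set nat) (I : set int) : set (set int) :=
  [set J | sg_ideal S J /\ ideal_equiv J I].

Definition ideal_class_monoid (S : set nat) : set (set (set int)) :=
  [set ideal_class S I | I in [set I | sg_ideal S I]].

(* Main.v *)
(* Every class of ideals contains exactly one ideal with minimum 0, and these
   normalized ideals are the sets E = S u A where A is a set of gaps and
   S + E <= E.  Adding a nonzero element of S to a pseudo-Frobenius number lands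
   in S, so every set A of pseudo-Frobenius numbers qualifies: this gives at least
   2^t classes.  Conversely, every gap lies below some pseudo-Frobenius number
   for <=_S, which a qualifying A must then contain along with the gap; so among
   the 2^(g-t) sets of gaps without pseudo-Frobenius numbers only the empty one
   qualifies. *)
Require Import Defs.
From mathcomp Require Import all_boot all_order all_algebra.
From mathcomp Require Import finmap zify.
From mathcomp Require Import all_classical.

Set Implicit Arguments.
Unset Strict Implicit.

Local Open Scope classical_set_scope.
Local Open Scope card_scope.
Local Open Scope nat_scope.

(* Ideals with minimum 0, seen as sets of naturals. *)
Definition normalized_ideals (S : set nat) : set (set nat) :=
  [set E | S `<=` E /\ forall s e, S s -> E e -> E (s + e)].

Lemma conductor (S : set nat) :
  numerical_semigroup S -> exists N, forall n, N <= n -> S n.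
Proof.
case=> _ _ /finite_seqP[s hs].
exists (\max_(x <- s) x).+1 => n hn; apply: contrapT => nSn.
have : n \in s by have : (~` S) n by []; rewrite hs.
move=> /(@leq_bigmax_seq _ s xpredT id n) /(_ isT) /=.
by rewrite leqNgt hn.
Qed.

Lemma intsetE (S : set nat) (n : nat) : intset S (Posz n) <-> S n.
Proof. by split=> [[m Sm [<-]]|Sn]; last by exists n. Qed.

Lemma intset_ge0 (S : set nat) (z : int) : intset S z -> (0 <= z)%R.
Proof. by case=> n _ <-. Qed.

Lemma intset_inj : injective intset.
Proof.
move=> A B AB; apply/seteqP.
by split=> n /intsetE; [rewrite AB|rewrite -AB] => /intsetE.
Qed.

Lemma translateE (z x : int) (I : set int) : translate z I x <-> I (x - z)%R.
Proof.
split=> [[y Iy <-]|Ixz]; first by have -> : (z + y - z = y)%R by lia.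
by exists (x - z)%R => //; lia.
Qed.

Lemma translateD (y z : int) (I : set int) :
  translate y (translate z I) = translate (y + z)%R I.
Proof.
apply/seteqP; split=> x; rewrite !translateE;
  by have -> : (x - y - z = x - (y + z))%R by lia.
Qed.

Lemma translate0 (I : set int) : translate 0%R I = I.
Proof.
by apply/seteqP; split=> x; rewrite translateE; have -> : (x - 0 = x)%R by lia.
Qed.

Lemma ideal_equiv_class (S : set nat) (I J : set int) :
  ideal_equiv I J -> ideal_class S I = ideal_class S J.
Proof.
move=> [z ->]; apply/seteqP; split=> K [idK [y KE]]; split=> //.
  by exists (y + z)%R; rewrite KE translateD.
by exists (y - z)%R; rewrite KE translateD; congr translate; lia.
Qed.

Lemma normalized_ideal (S E : set nat) :
  numerical_semigroup S -> normalized_ideals S E -> sg_ideal S (intset E).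
Proof.
move=> hS [SE Eadd]; have [S0 _ _] := hS; split.
- by exists (Posz 0); apply/intsetE; exact: SE.
- move=> _ [_ [s Ss <-] [_ [e Ee <-] <-]].
  by apply/(intsetE E (s + e))/Eadd.
(* Elements of [E] are naturals, so a shift by [N], past every gap, puts them all in [S]. *)
- have [N hN] := conductor hS; exists N; first exact: hN.
  by move=> _ [_ [e Ee <-] <-]; apply/(intsetE S (N + e))/hN; lia.
Qed.

(** The shift [s] that sends [I] into [S] bounds [I] below by [-s]; the well-ordering of the
    naturals then applies to [s + I]. *)
Lemma ideal_min (S : set nat) (I : set int) : sg_ideal S I ->
  exists2 m, I m & forall x, I x -> (m <= x)%R.
Proof.
move=> [[x0 Ix0] _ [s _ hs]].
have shiftP x : I x -> (0 <= s%:Z + x)%R.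
  by move=> Ix; apply/(@intset_ge0 S)/hs; exists x.
pose P (n : nat) : bool := `[< I (n%:Z - s%:Z)%R >].
have exP : exists n, P n.
  exists (absz (s%:Z + x0)%R); apply/asboolP.
  suff -> : ((absz (s%:Z + x0)%R)%:Z - s%:Z = x0)%R by [].
  by have := shiftP _ Ix0; lia.
case: (ex_minnP exP) => m /asboolP Im minm.
exists (m%:Z - s%:Z)%R => // x Ix.
have := shiftP _ Ix => sx; have : P (absz (s%:Z + x)%R).
  apply/asboolP; suff -> : ((absz (s%:Z + x)%R)%:Z - s%:Z = x)%R by [].
  lia.
by move=> /minm; lia.
Qed.

Lemma ideal_normalize (S : set nat) (I : set int) : sg_ideal S I ->
  exists2 E, normalized_ideals S E & ideal_equiv I (intset E).
Proof.
move=> idI; have [_ Iadd _] := idI; have [m Im minm] := ideal_min idI.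
have addI (s : nat) x : S s -> I x -> I (s%:Z + x)%R.
  by move=> Ss Ix; apply: Iadd; exists (Posz s); [exists s|exists x].
(* This is [I] moved so that its minimum [m] becomes 0; containing 0, it absorbs all of [S]. *)
exists [set n : nat | I (n%:Z + m)%R].
  split=> [s Ss|s e Ss Ie] /=; first exact: addI.
  by rewrite PoszD -GRing.addrA; exact: addI.
exists m; apply/seteqP; split=> x; rewrite translateE.
  move=> Ix; exists (absz (x - m)%R) => /=.
    suff -> : ((absz (x - m)%R)%:Z + m = x)%R by [].
    by have := minm _ Ix; lia.
  by have := minm _ Ix; lia.
by case=> n /= In e; have -> : (x = n%:Z + m)%R by lia.
Qed.

(** Both sets have minimum 0, which forces the translation between them to be zero. *)
Lemma ideal_class_inj (S : set nat) : numerical_semigroup S ->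
  {in normalized_ideals S &, injective (fun E => ideal_class S (intset E))}.
Proof.
move=> hS E F; rewrite !inE => hE hF EF; have [S0 _ _] := hS.
have [E0 F0] : E 0 /\ F 0 by split; [apply: hE.1|apply: hF.1].
have : ideal_class S (intset E) (intset E).
  by split; [exact: normalized_ideal|exists 0%R; rewrite translate0].
rewrite EF => -[_ [z eEF]]; apply: intset_inj.
(* From [E = z + F]: since 0 is in [E], [-z] is in [F]; since 0 is in [F], [z] is in [E]. *)
have z_le0 : (0 <= 0 - z)%R.
  apply: (@intset_ge0 F); apply/translateE; rewrite -eEF.
  exact/(intsetE E 0)/E0.
have z_ge0 : (0 <= z)%R.
  apply: (@intset_ge0 E); rewrite eEF; apply/translateE.
  by rewrite GRing.subrr; apply/(intsetE F 0).
have z0 : z = 0%R by lia.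
by rewrite eEF z0 translate0.
Qed.

Lemma card_ideal_class_monoid (S : set nat) : numerical_semigroup S ->
  ideal_class_monoid S #= normalized_ideals S.
Proof.
move=> hS; have <- : [set ideal_class S (intset E) | E in normalized_ideals S]
    = ideal_class_monoid S.
  apply/seteqP; split=> _ [I idI <-].
    by exists (intset I) => //; exact: normalized_ideal.
  have [E hE IE] := ideal_normalize idI.
  by exists E => //; rewrite (@ideal_equiv_class S I _ IE).
exact/inj_card_eq/ideal_class_inj.
Qed.

(** A gap that is not maximal has a strictly larger gap above it for [le_sg]; this climb stops
    because gaps are bounded by [N]. *)
Lemma pseudo_frobenius_above (S : set nat) (x : nat) :
  numerical_semigroup S -> gaps S x ->
  exists2 s, S s & pseudo_frobenius S (s + x).
Proof.
move=> hS; have [N hN] := conductor hS; have [S0 Sadd _] := hS.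
have [k] := ubnP (N - x); elim: k x => // k IHk x lek Gx.
have [PFx|nPFx] := pselect (pseudo_frobenius S x); first by exists 0.
have [y [Gy [s Ss sE] yx]] : exists y, [/\ gaps S y, le_sg S x y & y <> x].
  apply: contrapT => noy; apply: nPFx; split=> // y Gy xy.
  by apply: contrapT => yx; apply: noy; exists y.
(* With [x < y < N] the measure [N - x] strictly drops; without the bound, truncated subtraction
   could leave it at 0. *)
have yN : y < N by rewrite ltnNge; apply/negP => /hN.
have [|r Sr PFr] := IHk y _ Gy; first by lia.
by exists (r + s); [exact: Sadd|have -> : r + s + x = r + y by lia].
Qed.

Lemma pseudo_frobenius_add (S : set nat) (s x : nat) :
  S s -> pseudo_frobenius S x -> S (s + x) \/ s + x = x.
Proof.
move=> Ss [_ maxx]; have [|nSsx] := pselect (S (s + x)); first by left.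
by right; apply: maxx => //; exists s => //; lia.
Qed.

Lemma normalized_pseudo_frobenius (S A : set nat) :
  numerical_semigroup S -> A `<=` pseudo_frobenius S ->
  normalized_ideals S (S `|` A).
Proof.
move=> [_ Sadd _] APF; split=> [|s e Ss]; first exact: subsetUl.
case=> [Se|Ae]; first by left; exact: Sadd.
by case: (pseudo_frobenius_add Ss (APF _ Ae)) => [|->]; [left|right].
Qed.

Lemma normalized_ideal_pseudo_frobenius (S A : set nat) (x : nat) :
  numerical_semigroup S -> normalized_ideals S (S `|` A) ->
  gaps S x -> A x -> exists2 f, pseudo_frobenius S f & A f.
Proof.
move=> hS [_ addE] Gx Ax; have [s Ss PF] := pseudo_frobenius_above hS Gx.
exists (s + x) => //.
(* The sum is in [S] or in [A], and a pseudo-Frobenius number is a gap. *)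
by case: (addE s x Ss (or_intror Ax)) => // Ssx; case: PF.
Qed.

(** An ideal is encoded by the finite set of gaps it contains, so that the bounds become
    cardinalities of finite families. *)
Lemma card_normalized_ideals (S : set nat) : numerical_semigroup S ->
  normalized_ideals S #=
  [set` [fset A in fpowerset (fset_set (gaps S)) |
         `[< normalized_ideals S (S `|` [set` A])%classic >]]%fset].
Proof.
move=> [_ _ finG]; set V := [set` _].
have memG x : (x \in fset_set (gaps S)) = `[< gaps S x >].
  by rewrite in_fset_set // in_setE.
have VG (A : {fset nat}) x : V A -> x \in A -> ~ S x.
  rewrite /V /= !inE fpowersetE => /andP[/fsubsetP AG _] /AG.
  by rewrite memG => /asboolP.
have <- : [set S `|` [set` A] | A in V] = normalized_ideals S.
  apply/seteqP; split=> [_ [A VA <-]|E hE].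
    by move: VA; rewrite /V /= !inE => /andP[_ /asboolP].
  have finGE : finite_set (gaps S `&` E) by exact: finite_setIl.
  have EE : S `|` [set` fset_set (gaps S `&` E)] = E.
    rewrite fset_setK // setUIr setUv setTI.
    exact/setUidPr/(hE.1).
  exists (fset_set (gaps S `&` E)) => //; rewrite /V /= !inE EE.
  apply/andP; split; last exact/asboolP.
  by rewrite fpowersetE -fset_set_sub //; exact: subIsetl.
apply: inj_card_eq => A B; rewrite !inE => VA VB AB.
(* [C] avoids [S], so it is recovered from the union with [S] as its set of gaps. *)
have mem_gap (C : {fset nat}) x :
    V C -> (x \in C) = `[< (S `|` [set` C]) x /\ ~ S x >].
  move=> VC; apply/idP/asboolP => [xC|[[]]//].
  by split; [right|exact: VG VC xC].
by apply/fsetP => x; rewrite !mem_gap // AB.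
Qed.

Theorem proposition3p5 (S : set nat) (g t : nat)
    (hS : numerical_semigroup S) (hSN : S <> [set: nat])
    (hg : gaps S #= `I_g) (ht : pseudo_frobenius S #= `I_t) :
  exists n : nat,
    ideal_class_monoid S #= `I_n /\ 2 ^ t <= n <= 2 ^ g - 2 ^ (g - t) + 1.
Proof.
have [_ _ finG] := hS.
have finP : finite_set (pseudo_frobenius S) by exists t.
set G := fset_set (gaps S); set P := fset_set (pseudo_frobenius S).
have cardG : #|` G| = g by apply/card_eq_fsetP; rewrite fset_setK.
have cardP : #|` P| = t by apply/card_eq_fsetP; rewrite fset_setK.
have memG x : (x \in G) = `[< gaps S x >] by rewrite in_fset_set // in_setE.
have memP x : (x \in P) = `[< pseudo_frobenius S x >].
  by rewrite in_fset_set // in_setE.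
have PG : (P `<=` G)%fset.
  by apply/fsubsetP => x; rewrite memP memG => /asboolP[Gx _]; apply/asboolP.
set V := [fset A in fpowerset G | `[< normalized_ideals S (S `|` [set` A])%classic >]]%fset.
exists #|` V|; split.
  apply: card_eq_trans (card_ideal_class_monoid hS) _.
  apply: card_eq_trans (card_normalized_ideals hS) _.
  exact/card_eq_fsetP.
apply/andP; split.
  (* Lower bound: the whole powerset of [P] lies in [V]. *)
  rewrite -cardP -card_fpowerset; apply/fsubset_leq_card/fsubsetP => A.
  rewrite /V !inE !fpowersetE => AP.
  rewrite (fsubset_trans AP PG); apply/asboolP/normalized_pseudo_frobenius => //.
  by move=> x /(fsubsetP AP); rewrite memP => /asboolP.
(* Upper bound: a nonempty member of [V] meets [P], and the empty set, which encodes [S] itself,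
   accounts for the [+ 1]. *)
have subV : (V `<=` (fpowerset G `\` fpowerset (G `\` P)) `|` [fset fset0])%fset.
  apply/fsubsetP => A; rewrite /V !inE => /andP[AG /asboolP idA].
  rewrite AG andbT !fpowersetE; have [->|[x xA]] := fset_0Vmem A.
    by rewrite eqxx orbT.
  have [||f PFf Af] := normalized_ideal_pseudo_frobenius hS idA (x := x) => //.
    by move: AG; rewrite fpowersetE => /fsubsetP/(_ x xA); rewrite memG => /asboolP.
  apply/orP; left; apply/negP => /fsubsetP/(_ f Af).
  by rewrite inE memP => /andP[/asboolP].
(* Both truncated subtractions are exact, being cardinalities of differences with a subset. *)
have -> : 2 ^ g - 2 ^ (g - t) =
    #|` (fpowerset G `\` fpowerset (G `\` P))%fset|.
  rewrite cardfsDS ?fpowersetS ?fsubsetDl // !card_fpowerset cardfsDS //.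
  by rewrite cardG cardP.
apply: leq_trans (fsubset_leq_card subV) _.
by rewrite cardfsU cardfs1 leq_subr.
Qed.
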